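(* Let $\mathcal{F}:\mathbb{F}_{q^t}^r\to\mathbb{F}_q^{rt}$ be a vfr-map, $\mathcal{D}$ the Desarguesian spread obtained from $\mathcal{F}$, $L$ an $\mathbb{F}_q$-linear set of $\mathrm{PG}(r-1,q^t)$ and $n\geq 1$. Condition (A) holds for $(L,n)$ if and only if the following Condition (A') holds: for any two $n$-dimensional $\mathbb{F}_q$-subspaces $U,U'$ of $\mathbb{F}_q^{rt}$ with $\mathcal{B}(U)=L=\mathcal{B}(U')$, there is $\xi\in\Gamma\mathrm{L}(r,q^t)$ such that $\mathcal{F}(\xi)(U)=U'$.
   Context: A vfr-map $\mathcal{F}:\mathbb{F}_{q^t}^r\to\mathbb{F}_q^{rt}$ is an $\mathbb{F}_q$-linear bijection (e.g. obtained by fixing an $\mathbb{F}_q$-basis of $\mathbb{F}_{q^t}$ and taking coordinates). For $\xi\in\Gamma\mathrm{L}(r,q^t)$, $\mathcal{F}(\xi)$ is the map on $\mathbb{F}_q^{rt}$ with $\mathcal{F}(\xi)(\mathcal{F}(v))=\mathcal{F}(\xi(v))$. Points of $\mathrm{PG}(rt-1,q)$ are $\langle w\rangle_q$, points of $\mathrm{PG}(r-1,q^t)$ are $\langle v\rangle_{q^t}$; for a subspace $U$ of $\mathbb{F}_q^{rt}$, $\langle U\rangle_q$ is the projective subspace it determines. $\mathcal{D}=\{\{\langle\mathcal{F}(\alpha v)\rangle_q\mid\alpha\in\mathbb{F}_{q^t}^*\}\mid v\in\mathbb{F}_{q^t}^r\setminus\{0\}\}$; its element determined by $v$ corresponds to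 the point $\langle v\rangle_{q^t}$. For an $\mathbb{F}_q$-subspace $U$ of $\mathbb{F}_q^{rt}$, $\mathcal{B}(U)=\{\langle v\rangle_{q^t}\mid v\in\mathcal{F}^{-1}(U\setminus\{0\})\}$, and $\mathcal{B}(\langle U\rangle_q)=\mathcal{B}(U)$; sets of this form are $\mathbb{F}_q$-linear sets. Condition (A) for $(L,n)$: for any two $(n-1)$-dimensional subspaces $\pi,\pi'$ of $\mathrm{PG}(rt-1,q)$ with $\mathcal{B}(\pi)=L=\mathcal{B}(\pi')$, there is $\gamma\in\mathrm{P}\Gamma\mathrm{L}(rt,q)$ with (a) $\gamma(\pi)=\pi'$, (b) $\gamma$ preserves $\mathcal{D}$, (c) the map induced by $\gamma$ on $\mathrm{PG}(r-1,q^t)$ (via the correspondence between elements of $\mathcal{D}$ and points) is a collineation.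
   Formalization: The equivalence is proved for r ≥ 2; for r = 1 it is false: with q = 2, t = 6, n = 2 Condition (A) always holds, but ΓL(1,64) has order 378 and cannot be transitive on the 651 two-dimensional subspaces of F_64. *)

(* Defs.v *)
From HB Require Import structures.
From mathcomp Require Import all_boot all_order all_algebra all_field.
From mathcomp Require Import boolp classical_sets.

Set Implicit Arguments.
Unset Strict Implicit.
Unset Printing Implicit Defensive.

Import GRing.Theory.

Local Open Scope ring_scope.
Local Open Scope classical_set_scope.

(* F_q is a finite field F and F_{q^t} is a field extension E of F with
   [E : F] = t. *)

Section Projective.
Variables (K : fieldType) (m : nat).

(* The points of PG(m-1,K). *)
Definition pg_point : Type := {X : {vspace 'rV[K]_m} | \dim X == 1%N}.

(* The projective subspace <U>, as a set of points. *)
Definition proj (U : {vspace 'rV[K]_m}) : set pg_point :=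
  [set P : pg_point | (val P <= U)%VS].

Definition GammaL (g : 'rV[K]_m -> 'rV[K]_m) : Prop :=
  bijective g /\
  exists sigma : {rmorphism K -> K}, bijective sigma /\
    forall (a : K) (u v : 'rV[K]_m), g (a *: u + v) = sigma a *: g u + g v.

Definition PGammaL (phi : pg_point -> pg_point) : Prop :=
  exists2 g : 'rV[K]_m -> 'rV[K]_m, GammaL g &
    forall (P : pg_point) (v : 'rV[K]_m),
      val P = <[v]>%VS -> val (phi P) = <[g v]>%VS.

Definition lines : set (set pg_point) :=
  [set l | exists2 W : {vspace 'rV[K]_m}, \dim W = 2%N & l = proj W].

Definition preserves (phi : pg_point -> pg_point) (C : set (set pg_point)) : Prop :=
  [set phi @` X | X in C] = C.

(* On a projective line (m = 2) preservation of lines holds for every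
   bijection; there, as usual, a collineation is an element of PGammaL(2,K). *)
Definition collineation (phi : pg_point -> pg_point) : Prop :=
  [/\ bijective phi, preserves phi lines & m = 2%N -> PGammaL phi].

End Projective.

(* F-linear bijections from E^r to F^(rt); E^r is only an E-module in the
   library, so scalars of F act on it through a |-> a%:A. *)
Record vfr_map (F : finFieldType) (E : fieldExtType F) (r t : nat) := VfrMap {
  vfr :> 'rV[E]_r -> 'rV[F]_(r * t);
  vfr_inv : 'rV[F]_(r * t) -> 'rV[E]_r;
  vfrK : cancel vfr vfr_inv;
  vfr_invK : cancel vfr_inv vfr;
  vfr_linear : forall (a : F) (u v : 'rV[E]_r),
    vfr (a%:A *: u + v) = a *: vfr u + vfr v }.

Section FieldReduction.
Variables (F : finFieldType) (E : fieldExtType F) (r t : nat).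
Variable f : vfr_map E r t.

Definition vfr_conj (xi : 'rV[E]_r -> 'rV[E]_r) :
  'rV[F]_(r * t) -> 'rV[F]_(r * t) := fun w => f (xi (vfr_inv f w)).

Definition spread_elt (v : 'rV[E]_r) : set (pg_point F (r * t)) :=
  [set P | exists2 a : E, a != 0 & val P = <[f (a *: v)]>%VS].

Definition spread : set (set (pg_point F (r * t))) :=
  [set S | exists2 v : 'rV[E]_r, v != 0 & S = spread_elt v].

Definition corresponds (S : set (pg_point F (r * t))) (Q : pg_point E r) : Prop :=
  exists v : 'rV[E]_r, [/\ v != 0, S = spread_elt v & val Q = <[v]>%VS].

Definition induces (gamma : pg_point F (r * t) -> pg_point F (r * t))
    (phi : pg_point E r -> pg_point E r) : Prop :=
  forall S Q, corresponds S Q -> corresponds (gamma @` S) (phi Q).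

Definition B (U : {vspace 'rV[F]_(r * t)}) : set (pg_point E r) :=
  [set Q | exists2 v : 'rV[E]_r, f v \in U /\ f v != 0 & val Q = <[v]>%VS].

Definition linear_set (L : set (pg_point E r)) : Prop :=
  exists U : {vspace 'rV[F]_(r * t)}, L = B U.

(* The (n-1)-dimensional subspaces of PG(rt-1,q) are the proj U with
   dim U = n, and B (proj U) means B U. *)
Definition condA (L : set (pg_point E r)) (n : nat) : Prop :=
  forall U U' : {vspace 'rV[F]_(r * t)},
    \dim U = n -> \dim U' = n -> B U = L -> B U' = L ->
  exists gamma : pg_point F (r * t) -> pg_point F (r * t),
    [/\ PGammaL gamma,
        gamma @` proj U = proj U',
        preserves gamma spread
      & exists2 phi : pg_point E r -> pg_point E r,
          induces gamma phi & collineation phi].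

Definition condA' (L : set (pg_point E r)) (n : nat) : Prop :=
  forall U U' : {vspace 'rV[F]_(r * t)},
    \dim U = n -> \dim U' = n -> B U = L -> B U' = L ->
  exists2 xi : 'rV[E]_r -> 'rV[E]_r,
    GammaL xi & vfr_conj xi @` [set w | w \in U] = [set w | w \in U'].

End FieldReduction.

(* Main.v *)
(* Conjugation by [f] turns a semilinear map of [E^r] into one of [F^(rt)],
   because field automorphisms of [E] stabilise the subfield of order [#|F|];
   this gives (A') => (A).  Conversely, a semilinear map of [F^(rt)] that
   preserves the spread is, read on [E^r], an additive bijection sending
   one-dimensional [E]-subspaces onto one-dimensional [E]-subspaces.  For
   [r >= 2] the computation at the core of the fundamental theorem of
   projective geometry shows that such a map lies in GammaL(r,E). *)

From HB Require Import structures.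
Require Import Defs.
From mathcomp Require Import all_boot all_order all_algebra all_field.
From mathcomp Require Import boolp classical_sets.

Set Implicit Arguments.
Unset Strict Implicit.
Unset Printing Implicit Defensive.

Import GRing.Theory.

Local Open Scope ring_scope.
Local Open Scope classical_set_scope.

(** [GammaL] asks for a bundled morphism, while the scalar maps below arise as inverses or from
    choice, with their laws proved afterwards. *)
Lemma exists_rmorphism (R S : pzRingType) (s : R -> S) :
  zmod_morphism s -> monoid_morphism s ->
  exists sigma : {rmorphism R -> S}, sigma =1 s.
Proof.
move=> sB sM.
pose sBM := GRing.isZmodMorphism.Build R S s sB.
pose sMM := GRing.isMonoidMorphism.Build R S s sM.
by pose sigma : {rmorphism R -> S} := HB.pack s sBM sMM; exists sigma.
Qed.

Lemma surj_rmorphism_bij (K : fieldType) (s : {rmorphism K -> K}) :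
  (forall b, exists a, s a = b) -> bijective s.
Proof.
move=> /choice[h hK]; exists h => // a.
by apply: (fmorph_inj s); rewrite hK.
Qed.

(** * Semilinear bijections and their action on projective points *)

Section Semilinear.
Variables (K : fieldType) (m : nat).
Implicit Types (g h : 'rV[K]_m -> 'rV[K]_m) (u v w : 'rV[K]_m).
Implicit Types (P : pg_point K m) (phi : pg_point K m -> pg_point K m).

Definition induced_by g phi :=
  forall P v, val P = <[v]>%VS -> val (phi P) = <[g v]>%VS.

Lemma semilinear0 (s : {rmorphism K -> K}) g :
  (forall a u v, g (a *: u + v) = s a *: g u + g v) -> g 0 = 0.
Proof.
move=> gL; have := gL 1 0 0.
rewrite rmorph1 !scale1r addr0 => /eqP.
by rewrite -subr_eq0 opprD addrA subrr sub0r oppr_eq0 => /eqP.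
Qed.

Lemma GammaL0 g : GammaL g -> g 0 = 0.
Proof. by case=> _ [s [_ /semilinear0]]. Qed.

Lemma GammaLZ g : GammaL g ->
  exists2 s : {rmorphism K -> K}, bijective s &
    forall a v, g (a *: v) = s a *: g v.
Proof.
move=> gG; have g0 := GammaL0 gG; case: gG => _ [s [sB gL]]; exists s => // a v.
by have := gL a v 0; rewrite g0 !addr0.
Qed.

Lemma GammaLD g u v : GammaL g -> g (u + v) = g u + g v.
Proof.
case=> _ [s [sB gL]].
by have := gL 1 u v; rewrite rmorph1 !scale1r.
Qed.

Lemma GammaL_eq0 g v : GammaL g -> (g v == 0) = (v == 0).
Proof.
move=> gG; apply/eqP/eqP => [gv0|->]; last exact: GammaL0.
by apply: (bij_inj gG.1); rewrite gv0 GammaL0.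
Qed.

(** The inverse map is semilinear for the inverse of the companion automorphism. *)
Lemma GammaL_inv g : GammaL g ->
  exists h, [/\ GammaL h, cancel g h & cancel h g].
Proof.
case=> -[h gK hK] [s [[z sK zK] gL]]; exists h; split => //; split; first by exists g.
have [z' z'E] := exists_rmorphism (can2_zmod_morphism sK zK)
                                  (can2_monoid_morphism sK zK).
exists z'; split; first by exists s => a; rewrite z'E.
by move=> a u v; apply: (can_inj gK); rewrite hK gL z'E zK !hK.
Qed.

Lemma GammaL_line g u v : GammaL g -> u \in <[v]>%VS -> g u \in <[g v]>%VS.
Proof.
move=> /GammaLZ[s _ gZ] /vlineP[a ->].
by apply/vlineP; exists (s a); rewrite gZ.
Qed.

Lemma GammaL_line_eq g u v : GammaL g -> <[u]>%VS = <[v]>%VS -> <[g u]>%VS = <[g v]>%VS.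
Proof.
move=> gG uv; apply/eqP; rewrite eqEsubv -!memvE.
by rewrite !GammaL_line // ?uv ?memv_line // -uv memv_line.
Qed.

Lemma pg_pointP P : exists2 v, v != 0 & val P = <[v]>%VS.
Proof.
have dP := valP P; exists (vpick (val P)).
  by rewrite vpick0 -dimv_eq0 (eqP dP).
apply/esym/eqP; rewrite eqEdim -memvE memv_pick dim_vline vpick0 -dimv_eq0.
by rewrite (eqP dP).
Qed.

Lemma pg_point_exists v : v != 0 -> exists P, val P = <[v]>%VS.
Proof.
move=> v0; have dv : \dim <[v]>%VS == 1%N by rewrite dim_vline v0.
by exists (exist (fun X : {vspace 'rV[K]_m} => \dim X == 1%N) _ dv).
Qed.

(** The line spanned by [g v] depends only on the line spanned by [v], so an image can be chosen
    point by point. *)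
Lemma induced_by_exists g : GammaL g -> exists phi, induced_by g phi.
Proof.
move=> gG.
have /choice[phi phiP] : forall P, exists Q : pg_point K m, forall v,
    val P = <[v]>%VS -> val Q = <[g v]>%VS.
  move=> P; have [u u0 Pu] := pg_pointP P.
  have [|Q Qu] := @pg_point_exists (g u); first by rewrite GammaL_eq0.
  by exists Q => v; rewrite Pu Qu => /(GammaL_line_eq gG).
by exists phi.
Qed.

Lemma induced_by_cancel g h phi psi :
  cancel g h -> induced_by g phi -> induced_by h psi -> cancel phi psi.
Proof.
move=> gK gphi hpsi P; have [v _ Pv] := pg_pointP P; apply: val_inj.
by rewrite (hpsi _ _ (gphi _ _ Pv)) gK.
Qed.

Lemma induced_by_bij g phi : GammaL g -> induced_by g phi -> bijective phi.
Proof.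
move=> gG gphi; have [h [hG gK hK]] := GammaL_inv gG.
have [psi hpsi] := induced_by_exists hG.
by exists psi; [exact: induced_by_cancel gphi hpsi | exact: induced_by_cancel hpsi gphi].
Qed.

(** As [g] need not be linear, the span of the images of a basis of [W] stands in for a linear
    image. *)
Lemma GammaL_span g (W : {vspace 'rV[K]_m}) : GammaL g ->
  exists2 W' : {vspace 'rV[K]_m}, (\dim W' <= \dim W)%N &
    forall v, v \in W -> g v \in W'.
Proof.
move=> gG; exists <<map g (vbasis W)>>%VS.
  by apply: leq_trans (dim_span _) _; rewrite size_map size_tuple.
move=> v /coord_vbasis ->; have [s _ gZ] := GammaLZ gG.
apply: (big_ind (fun x => g x \in _)) => [|x y gx gy|i _].
- by rewrite GammaL0 // mem0v.
- by rewrite GammaLD // memvD.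
by rewrite gZ memvZ // memv_span // map_f // mem_nth // size_tuple.
Qed.

(** Going forth by [g] and back by its inverse yields a space that contains [W] and whose dimension
    has not grown, so both bounds of [GammaL_span] are equalities. *)
Lemma GammaL_image g (W : {vspace 'rV[K]_m}) : GammaL g ->
  exists2 W' : {vspace 'rV[K]_m}, \dim W' = \dim W &
    forall v, (g v \in W') = (v \in W).
Proof.
move=> gG; have [h [hG gK _]] := GammaL_inv gG.
have [W1 d1 gW] := GammaL_span W gG; have [W2 d2 hW] := GammaL_span W1 hG.
have sW : (W <= W2)%VS.
  by apply/subvP => v /gW/hW; rewrite gK.
have dW := dimvS sW.
have eW : W = W2 by apply/eqP; rewrite eqEdim sW (leq_trans d2 d1).
exists W1; first by apply/eqP; rewrite eqn_leq d1 (leq_trans dW d2).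
by move=> v; apply/idP/idP => [/hW|/gW //]; rewrite gK -eW.
Qed.

Lemma induced_by_proj g phi (W W' : {vspace 'rV[K]_m}) :
  GammaL g -> induced_by g phi -> (forall v, (g v \in W') = (v \in W)) ->
  phi @` proj W = proj W'.
Proof.
move=> gG gphi gW; have [h [hG gK hK]] := GammaL_inv gG.
apply/seteqP; split=> [_ [P /= PW <-]|Q /= QW].
  rewrite /proj /=; have [v _ Pv] := pg_pointP P.
  by move: PW; rewrite /proj /= (gphi _ _ Pv) Pv -!memvE gW.
have [v v0 Qv] := pg_pointP Q.
have [|P Pv] := @pg_point_exists (h v); first by rewrite GammaL_eq0.
exists P; last by apply: val_inj; rewrite (gphi _ _ Pv) hK.
by move: QW; rewrite /proj /= Qv Pv -!memvE -gW hK.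
Qed.

Lemma induced_by_collineation g phi :
  GammaL g -> induced_by g phi -> collineation phi.
Proof.
move=> gG gphi; split; [exact: induced_by_bij gphi | | by move=> _; exists g].
have [h [hG gK hK]] := GammaL_inv gG.
apply/seteqP; split=> [_ [_ [W dW ->] <-]|_ [W dW ->]].
  have [W' dW' gW] := GammaL_image W gG.
  by exists W'; [rewrite dW' | apply: induced_by_proj gphi gW].
(* The line sent onto [proj W] comes from the image of [W] under the inverse. *)
have [W' dW' hW] := GammaL_image W hG.
exists (proj W'); first by exists W'; rewrite // dW'.
by apply: (induced_by_proj gG gphi) => v; rewrite -hW gK.
Qed.

Lemma exists_notin_vline v : (2 <= m)%N -> exists w, w \notin <[v]>%VS.
Proof.
move=> m2; apply: contrapT => nw.
have : (fullv <= <[v]>)%VS.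
  apply/subvP => w _; apply: contraT => wv.
  by case: nw; exists w.
move=> /dimvS; rewrite dimvf dim_vline /dim /= mul1n.
by move: m2; case: (v != 0) => /=; case: (m) => [|[|]].
Qed.

(** * Additive bijections carrying lines through 0 onto lines through 0 *)

Section LinePreserving.
Variable g : 'rV[K]_m -> 'rV[K]_m.
Hypothesis m2 : (2 <= m)%N.
Hypothesis g_bij : bijective g.
Hypothesis gD : forall u v, g (u + v) = g u + g v.
Hypothesis g_line : forall a v, exists b, g (a *: v) = b *: g v.
Hypothesis g_line_onto : forall b v, exists a, b *: g v = g (a *: v).

Let g0 : g 0 = 0.
Proof. by apply: (addrI (g 0)); rewrite -gD !addr0. Qed.

Let g_neq0 v : v != 0 -> g v != 0.
Proof.
by apply: contra_neq => gv0; apply: (bij_inj g_bij); rewrite gv0.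
Qed.

(* Comparing [g (a (u + v))] with [g (a u) + g (a v)] in the independent pair
   [g u], [g v] shows that the multiplier of [a] does not depend on the
   vector. *)
Lemma line_multiplier_indep a bu bv u v : u != 0 -> v \notin <[u]>%VS ->
  g (a *: u) = bu *: g u -> g (a *: v) = bv *: g v -> bu = bv.
Proof.
move=> u0 vu gu gv; have [bw] := g_line a (u + v).
rewrite scalerDr !gD gu gv scalerDr => /eqP.
rewrite -subr_eq0 opprD addrACA -!scalerBl addr_eq0 -scaleNr opprB => /eqP e.
have bwv : bw - bv = 0.
  apply: contraNeq vu => c0; apply/vlineP.
  have [a' a'P] := g_line_onto ((bw - bv)^-1 * (bu - bw)) u.
  exists a'; apply: (bij_inj g_bij).
  by rewrite -a'P -scalerA e scalerA mulVf // scale1r.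
move: e; rewrite bwv scale0r => /eqP.
rewrite scaler_eq0 (negPf (g_neq0 u0)) orbF subr_eq0 => /eqP ->.
exact: subr0_eq bwv.
Qed.

(** Two independent vectors [u] and [w] suffice as references: every nonzero vector is independent
    of at least one of them. *)
Lemma line_multiplier_uniform a : exists b, forall v, g (a *: v) = b *: g v.
Proof.
(* The span of 0 is the zero space, so a vector outside it is a nonzero vector. *)
have [u u0] := exists_notin_vline 0 m2.
have {}u0 : u != 0 by apply: contraNneq u0 => ->; rewrite mem0v.
have [w wu] := exists_notin_vline u m2.
have [b gu] := g_line a u; have [b' gw] := g_line a w.
have bb' := line_multiplier_indep u0 wu gu gw; rewrite -{}bb' in gw.
exists b => v; have [->|v0] := eqVneq v 0; first by rewrite scaler0 g0 scaler0.
have [c gv] := g_line a v; rewrite gv; congr (_ *: _).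
have [vu|vu] := boolP (v \in <[u]>%VS); last first.
  by rewrite (line_multiplier_indep u0 vu gu gv).
(* Here [v] is on the line of [u]; since [w] is off that line, it is off the line of [v] as well. *)
apply: (line_multiplier_indep v0 _ gv gw).
apply: contra wu => /vlineP[d ->]; apply: memvZ; exact: vu.
Qed.

(** The common multiplier [s a] is the companion automorphism: its ring laws are read off at a
    single nonzero [g u], and [g_line_onto] makes it surjective. *)
Lemma line_preserving_GammaL : GammaL g.
Proof.
split=> //; have [s gZ] := choice line_multiplier_uniform.
have [u u0] := exists_notin_vline 0 m2.
have {u0} gu0 : g u != 0.
  by apply: g_neq0; apply: contraNneq u0 => ->; rewrite mem0v.
have guI a b : a *: g u = b *: g u -> a = b.
  move/eqP; rewrite -subr_eq0 -scalerBl scaler_eq0 (negPf gu0) orbF subr_eq0.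
  by move/eqP.
have sD a b : s (a + b) = s a + s b.
  by apply: guI; rewrite -gZ !scalerDl gD !gZ.
have sB : zmod_morphism s.
  by move=> a b; apply/eqP; rewrite eq_sym subr_eq -sD subrK.
have sM : monoid_morphism s.
  split=> [|a b]; apply: guI; first by rewrite -gZ !scale1r.
  by rewrite -gZ -scalerA !gZ scalerA.
have [sigma sigmaE] := exists_rmorphism sB sM.
exists sigma; split=> [|a v w]; last by rewrite gD gZ sigmaE.
apply: surj_rmorphism_bij => b; have [a ab] := g_line_onto b u.
by exists a; apply: guI; rewrite sigmaE -gZ.
Qed.

End LinePreserving.

End Semilinear.

(** * The vfr-map, and automorphisms of [E] restricted to [F] *)

Section FieldReduction.
Variables (F : finFieldType) (E : fieldExtType F) (r t : nat).
Variable f : vfr_map E r t.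
Implicit Types (xi : 'rV[E]_r -> 'rV[E]_r) (u v w : 'rV[E]_r).

Lemma vfr0 : f 0 = 0.
Proof.
have := vfr_linear f 1 0 0; rewrite !scale1r addr0 => /eqP.
by rewrite -subr_eq0 opprD addrA subrr sub0r oppr_eq0 => /eqP.
Qed.

Lemma vfrD u v : f (u + v) = f u + f v.
Proof. by have := vfr_linear f 1 u v; rewrite !scale1r. Qed.

Lemma vfrZ (a : F) v : f (a%:A *: v) = a *: f v.
Proof. by have := vfr_linear f a v 0; rewrite vfr0 !addr0. Qed.

Lemma vfr_inv0 : vfr_inv f 0 = 0.
Proof. by rewrite -vfr0 vfrK. Qed.

Lemma vfr_invD x y : vfr_inv f (x + y) = vfr_inv f x + vfr_inv f y.
Proof. by apply: (can_inj (vfrK f)); rewrite vfrD !vfr_invK. Qed.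

Lemma vfr_invZ (a : F) x : vfr_inv f (a *: x) = a%:A *: vfr_inv f x.
Proof. by apply: (can_inj (vfrK f)); rewrite vfrZ !vfr_invK. Qed.

Lemma vfr_eq0 v : (f v == 0) = (v == 0).
Proof. by rewrite -{1}vfr0 (can_eq (vfrK f)). Qed.

Lemma vfr_vlineP u v : f u \in <[f v]>%VS -> exists a : F, u = a%:A *: v.
Proof.
by case/vlineP=> a fuv; exists a; apply: (can_inj (vfrK f)); rewrite vfrZ.
Qed.

(* [F] is the set of fixed points of [x |-> x ^ #|F|] in [E], and every
   endomorphism of [E] commutes with this power map. *)
Lemma rmorph_subfield (s : {rmorphism E -> E}) :
  exists2 s0 : {rmorphism F -> F}, bijective s0 & forall a, s a%:A = (s0 a)%:A.
Proof.
have in1 (x : E) : (x \in 1%VS) = (x ^+ #|F| == x).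
  by have := Fermat's_little_theorem (1%AS : {subfield E}) x;
     rewrite dimv1 expn1.
have /choice[s0 s0E] (a : F) : exists b : F, s a%:A = b%:A.
  apply/vlineP; rewrite in1 -rmorphXn; apply/eqP; congr (s _).
  by apply/eqP; rewrite -in1 memvZ // mem1v.
have AI : injective (fun a : F => a%:A : E) by exact: (fmorph_inj (in_alg E)).
have s0B : zmod_morphism s0.
  by move=> a b; apply: AI; rewrite /= -s0E !scalerBl rmorphB /= !s0E.
have s0M : monoid_morphism s0.
  split=> [|a b]; apply: AI; rewrite /= -s0E; first by rewrite !scale1r rmorph1.
  have AM (c d : F) : (c * d)%:A = c%:A * d%:A :> E := rmorphM (in_alg E) c d.
  by rewrite AM (rmorphM s) !s0E AM.
have [s1 s1E] := exists_rmorphism s0B s0M.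
exists s1; last by move=> a; rewrite s1E s0E.
exact: injF_bij (fmorph_inj s1).
Qed.

(** The companion automorphism over [F] is the restriction of the one over [E]. *)
Lemma vfr_conj_GammaL xi : GammaL xi -> GammaL (vfr_conj f xi).
Proof.
move=> xG; split.
  have [z [_ xK zK]] := GammaL_inv xG.
  by exists (vfr_conj f z) => x; rewrite /vfr_conj vfrK ?xK ?zK vfr_invK.
have [s sB xZ] := GammaLZ xG; have [s0 s0B s0E] := rmorph_subfield s.
exists s0; split=> // a x y.
by rewrite /vfr_conj vfr_invD GammaLD // vfrD vfr_invZ xZ s0E vfrZ.
Qed.

(** * Spread elements and semilinear maps of [E^r] *)

(** The factor from [F] between two generators of [P] is absorbed into the scalar from [E], and that
    scalar is nonzero because [P] is a point. *)
Lemma spread_eltP (P : pg_point F (r * t)) v w : v != 0 ->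
  val P = <[f w]>%VS -> spread_elt f v P <-> exists b, w = b *: v.
Proof.
move=> v0 Pw; split=> [[a a0 Pa]|[b wb]].
  have [|c ->] := @vfr_vlineP w (a *: v); first by rewrite -Pa Pw memv_line.
  by exists (c%:A * a); rewrite scalerA.
exists b; last by rewrite Pw wb.
apply: contraTneq (valP P) => b0.
by rewrite /= Pw wb b0 scale0r vfr0 dim_vline eqxx.
Qed.

Lemma spread_point (P : pg_point F (r * t)) :
  exists2 w, w != 0 & val P = <[f w]>%VS.
Proof.
have [x x0 Px] := pg_pointP P.
by exists (vfr_inv f x); rewrite ?vfr_invK // -vfr_eq0 vfr_invK.
Qed.

Lemma spread_point_exists w : w != 0 ->
  exists P : pg_point F (r * t), val P = <[f w]>%VS.
Proof. by move=> w0; apply: pg_point_exists; rewrite vfr_eq0. Qed.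

Lemma spread_elt_image xi (gamma : pg_point F (r * t) -> pg_point F (r * t)) v :
  GammaL xi -> induced_by (vfr_conj f xi) gamma -> v != 0 ->
  gamma @` spread_elt f v = spread_elt f (xi v).
Proof.
move=> xG xgamma v0; have xv0 : xi v != 0 by rewrite GammaL_eq0.
have gE P w : val P = <[f w]>%VS -> val (gamma P) = <[f (xi w)]>%VS.
  by move=> /xgamma; rewrite /vfr_conj vfrK.
have [s [z sK zK] xZ] := GammaLZ xG; have [h [hG xK hK]] := GammaL_inv xG.
apply/seteqP; split=> [_ [P Pv <-]|Q Qv].
  have [w w0 Pw] := spread_point P.
  have [b wb] := (spread_eltP v0 Pw).1 Pv.
  by apply/(spread_eltP xv0 (gE _ _ Pw)); exists (s b); rewrite wb xZ.
have [w w0 Qw] := spread_point Q.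
have [b wb] := (spread_eltP xv0 Qw).1 Qv.
have [|P Pw] := @spread_point_exists (h w); first by rewrite GammaL_eq0.
exists P; last by apply: val_inj; rewrite (gE _ _ Pw) hK.
apply/(spread_eltP v0 Pw); exists (z b).
by rewrite wb; apply: (can_inj xK); rewrite hK xZ zK.
Qed.

Lemma spread_preserved xi (gamma : pg_point F (r * t) -> pg_point F (r * t)) :
  GammaL xi -> induced_by (vfr_conj f xi) gamma -> preserves gamma (spread f).
Proof.
move=> xG xgamma; have [h [hG xK hK]] := GammaL_inv xG.
apply/seteqP; split=> [_ [_ [v v0 ->] <-]|_ [v v0 ->]].
  by exists (xi v); [rewrite GammaL_eq0 | exact: spread_elt_image].
have hv0 : h v != 0 by rewrite GammaL_eq0.
exists (spread_elt f (h v)); first by exists (h v).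
by rewrite (spread_elt_image xG xgamma hv0) hK.
Qed.

(** * The two implications *)

Lemma condA'_condA L n : condA' f L n -> condA f L n.
Proof.
move=> A' U U' dU dU' BU BU'.
have [xi xG xU] := A' U U' dU dU' BU BU'.
have gG := vfr_conj_GammaL xG.
(* The conjugate of [xi] acts on the points over [F], and [xi] itself on the points over [E]. *)
have [gamma xgamma] := induced_by_exists gG.
have [phi xphi] := induced_by_exists xG.
exists gamma; split; first by exists (vfr_conj f xi).
- apply: (induced_by_proj gG xgamma) => x; apply/idP/idP => [gx|xUx].
    have : [set` U'] (vfr_conj f xi x) by [].
    by rewrite -xU => -[y yU /(bij_inj gG.1) <-].
  have : (vfr_conj f xi @` [set w | w \in U]) (vfr_conj f xi x) by exists x.
  by rewrite xU.
- exact: spread_preserved xgamma.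
exists phi; last exact: induced_by_collineation xphi.
move=> _ Q [v [v0 -> Qv]]; exists (xi v); split; first by rewrite GammaL_eq0.
  exact: spread_elt_image.
exact: xphi.
Qed.

(** A spread element records an [E]-line, so preserving the spread gives the line hypotheses of
    [line_preserving_GammaL] for the pullback of [g]. *)
Lemma spread_preserving_GammaL g (gamma : pg_point F (r * t) -> pg_point F (r * t)) :
  (2 <= r)%N -> GammaL g -> induced_by g gamma -> preserves gamma (spread f) ->
  GammaL (fun v => vfr_inv f (g (f v))).
Proof.
move=> r2 gG ggamma gS; set G := fun v => _.
have [h [hG gK hK]] := GammaL_inv gG.
have [s [z sK zK] gZ] := GammaLZ gG.
have fG v : f (G v) = g (f v) by rewrite /G vfr_invK.
have G0 : G 0 = 0 by rewrite /G vfr0 GammaL0 // vfr_inv0.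
have G_eq0 v : (G v == 0) = (v == 0) by rewrite -vfr_eq0 fG GammaL_eq0 // vfr_eq0.
have GZ c v : G ((z c)%:A *: v) = c%:A *: G v.
  by rewrite /G vfrZ gZ zK vfr_invZ.
have gE P v : val P = <[f v]>%VS -> val (gamma P) = <[f (G v)]>%VS.
  by move=> /ggamma; rewrite fG.
have G_image v : v != 0 -> exists2 v', v' != 0 &
    gamma @` spread_elt f v = spread_elt f v'.
  move=> v0.
  have : [set gamma @` X | X in spread f] (gamma @` spread_elt f v).
    by exists (spread_elt f v) => //; exists v.
  by rewrite gS => -[v' v'0 e]; exists v'.
have G_mul v v' : v != 0 -> v' != 0 ->
    gamma @` spread_elt f v = spread_elt f v' ->
    forall a, exists b, G (a *: v) = b *: v'.
  move=> v0 v'0 e a; have [->|a0] := eqVneq a 0.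
    by exists 0; rewrite !scale0r G0.
  have [|P Pv] := @spread_point_exists (a *: v); first by rewrite scaler_eq0 negb_or a0.
  apply/(spread_eltP v'0 (gE _ _ Pv)); rewrite -e; exists P => //.
  by apply/(spread_eltP v0 Pv); exists a.
apply: (line_preserving_GammaL r2).
- exists (fun v => vfr_inv f (h (f v))) => v; first by rewrite fG gK vfrK.
  by rewrite /G vfr_invK hK vfrK.
- by move=> u v; rewrite /G vfrD GammaLD // vfr_invD.
- move=> a v; have [->|v0] := eqVneq v 0.
    by exists 0; rewrite scaler0 G0 scaler0.
  have [v' v'0 /(G_mul _ _ v0 v'0) GvE] := G_image v v0.
  have [b Gav] := GvE a; have [c] := GvE 1; rewrite scale1r => Gv.
  have c0 : c != 0.
    by apply: contraNneq v0 => c0; rewrite -G_eq0 Gv c0 scale0r.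
  (* The scalars [b] and [c] are relative to [v'], some generator of the image line; the quotient is
     relative to [G v]. *)
  by exists (b / c); rewrite Gav Gv scalerA divfK.
move=> b v; have [->|b0] := eqVneq b 0.
  by exists 0; rewrite !scale0r G0.
have [->|v0] := eqVneq v 0; first by exists 0; rewrite G0 !scaler0 G0.
have [v' v'0 e] := G_image v v0.
have [c] := G_mul _ _ v0 v'0 e 1; rewrite scale1r => Gv.
(* The point of [b *: G v] lies in the image spread element, so it is the image of a point generated
   by some [a *: v]. This fixes [b *: G v] up to a factor [d] from [F], which is pulled back through
   [G] as [z d]. *)
have [|Q Qv] := @spread_point_exists (b *: G v).
  by rewrite scaler_eq0 negb_or b0 G_eq0.
have : spread_elt f v' Q.
  by apply/(spread_eltP v'0 Qv); exists (b * c); rewrite Gv scalerA.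
rewrite -e => -[P Pv PQ]; have [w w0 Pw] := spread_point P.
have [a wa] := (spread_eltP v0 Pw).1 Pv.
have [|d ->] := @vfr_vlineP (b *: G v) (G w).
  by rewrite -(gE _ _ Pw) PQ Qv memv_line.
by exists ((z d)%:A * a); rewrite -scalerA -wa GZ.
Qed.

Lemma condA_condA' L n : (2 <= r)%N -> condA f L n -> condA' f L n.
Proof.
move=> r2 A U U' dU dU' BU BU'.
have [gamma [[g gG ggamma] gU gS _]] := A U U' dU dU' BU BU'.
exists (fun v => vfr_inv f (g (f v))); first exact: spread_preserving_GammaL gS.
(* Conjugation undoes the pullback, so it remains to lift the equality of projective subspaces to
   vectors. *)
have -> : vfr_conj f (fun v => vfr_inv f (g (f v))) = g.
  by apply/funext => x; rewrite /vfr_conj !vfr_invK.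
have [h [hG gK hK]] := GammaL_inv gG.
apply/seteqP; split=> [_ [x /= xU <-]|y /= yU'].
  have [->|x0] := eqVneq x 0; first by rewrite GammaL0 // mem0v.
  have [P Px] := pg_point_exists x0.
  have : (gamma @` proj U) (gamma P) by exists P; rewrite // /proj /= Px -memvE.
  by rewrite gU /proj /= (ggamma _ _ Px) -memvE.
exists (h y) => //; have [->|y0] := eqVneq y 0; first by rewrite /= GammaL0 // mem0v.
have [Q Qy] := pg_point_exists y0.
have : proj U' Q by rewrite /proj /= Qy -memvE.
rewrite -gU => -[P PU PQ]; have [x x0 Px] := pg_pointP P.
(* Equality of points only makes [y] a multiple of [g x]; hence [h y] is a multiple of [x], which is
   enough to lie in [U]. *)
have hyx : h y \in <[h (g x)]>%VS.
  by apply: GammaL_line => //; rewrite -(ggamma _ _ Px) PQ Qy memv_line.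
by move: PU; rewrite /proj /= Px => /subvP; apply; rewrite gK in hyx.
Qed.

End FieldReduction.

Theorem theorem6p4 (F : finFieldType) (E : fieldExtType F) (r t n : nat)
    (ht : \dim {: E} = t) (hr : (2 <= r)%N) (hn : (1 <= n)%N)
    (f : vfr_map E r t) (L : set (pg_point E r)) (hL : linear_set f L) :
  condA f L n <-> condA' f L n.
Proof. by split; [exact: condA_condA' | exact: condA'_condA]. Qed.
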